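(* There is an algorithm which, given an integer $k\ge 1$ and one faulty node $(x,y)$, or two faulty nodes $(a,b)$ and $(c,d)$, of the dense Gaussian network $G_k=G(k+(k+1)i)$, outputs a node $NS$ of $G_k$ whose graph distance from each given faulty node is exactly $k$, and which runs in time $O(k)$ in the worst case.
   Context: For an integer $k\ge 1$ put $\pi=k+(k+1)i\in\mathbb{Z}[i]$. The dense Gaussian network $G_k=G(\pi)$ is the undirected graph whose vertex (node) set is the set of residue classes $\mathbb{Z}[i]_\pi=\mathbb{Z}[i]/(\pi)$, and in which two vertices $\alpha,\beta$ are adjacent if and only if $\beta-\alpha\equiv \pm1$ or $\pm i \pmod \pi$. Every node has a unique representative $x+yi$ with integers $x,y$ satisfying $|x|+|y|\le k$, and is given as the pair $(x,y)$. Graph distance is the minimum number of edges on a path; the diameter of $G_k$ is $k$. Running time is counted in the unit-cost model: each integer arithmetic operation or comparison, each reduction of a Gaussian integer modulo $\pi$ to its representative, and each evaluation of the graph distance between two given nodes costs $O(1)$. *)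

(* Defs.v *)
From HB Require Import structures.
From mathcomp Require Import all_boot all_order all_algebra.
From mathcomp Require Import ring.
From mathcomp Require Import boolp classical_sets.

Set Implicit Arguments.
Unset Strict Implicit.
Unset Printing Implicit Defensive.

Import Order.TTheory GRing.Theory Num.Theory.
Local Open Scope ring_scope.
Local Open Scope quotient_scope.

(** * Gaussian integers *)

(* A record rather than [int * int], whose canonical ring structure has the
   componentwise product. *)
Record gint := GInt { re : int; im : int }.

Definition gint_pair (z : gint) : int * int := (re z, im z).
Definition pair_gint (p : int * int) : gint := GInt p.1 p.2.

Lemma gint_pairK : cancel gint_pair pair_gint.
Proof. by case. Qed.

HB.instance Definition _ := Choice.copy gint (can_type gint_pairK).

Definition gint_add (z w : gint) := GInt (re z + re w) (im z + im w).
Definition gint_opp (z : gint) := GInt (- re z) (- im z).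
Definition gint_mul (z w : gint) :=
  GInt (re z * re w - im z * im w) (re z * im w + im z * re w).

Lemma gint_addA : associative gint_add.
Proof. by move=> [a b] [c d] [e f]; congr GInt => /=; ring. Qed.
Lemma gint_addC : commutative gint_add.
Proof. by move=> [a b] [c d]; congr GInt => /=; ring. Qed.
Lemma gint_add0 : left_id (GInt 0 0) gint_add.
Proof. by move=> [a b]; congr GInt => /=; ring. Qed.
Lemma gint_addN : left_inverse (GInt 0 0) gint_opp gint_add.
Proof. by move=> [a b]; congr GInt => /=; ring. Qed.

HB.instance Definition _ :=
  GRing.isZmodule.Build gint gint_addA gint_addC gint_add0 gint_addN.

Lemma gint_mulA : associative gint_mul.
Proof. by move=> [a b] [c d] [e f]; congr GInt => /=; ring. Qed.
Lemma gint_mulC : commutative gint_mul.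
Proof. by move=> [a b] [c d]; congr GInt => /=; ring. Qed.
Lemma gint_mul1 : left_id (GInt 1 0) gint_mul.
Proof. by move=> [a b]; congr GInt => /=; ring. Qed.
Lemma gint_mulD : left_distributive gint_mul +%R.
Proof. by move=> [a b] [c d] [e f]; congr GInt => /=; ring. Qed.
Lemma gint_1_neq0 : GInt 1 0 != 0.
Proof. by []. Qed.

HB.instance Definition _ := GRing.Zmodule_isComNzRing.Build gint
  gint_mulA gint_mulC gint_mul1 gint_mulD gint_1_neq0.

(** * The dense Gaussian network *)

Definition gpi (k : nat) : gint := GInt k%:Z k.+1%:Z.

Definition gpi_ideal (k : nat) : pred gint :=
  fun z => `[< exists q : gint, z = q * gpi k >].

Lemma gpi_ideal_zmod_closed k : zmod_closed (gpi_ideal k).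
Proof.
split=> [|z w /asboolP[p ->] /asboolP[q ->]]; apply/asboolP.
- by exists 0; rewrite mul0r.
- by exists (p - q); rewrite mulrBl.
Qed.

HB.instance Definition _ k :=
  GRing.isZmodClosed.Build gint (gpi_ideal k) (gpi_ideal_zmod_closed k).

(* Quotient by [zmodClosed] only: adjacency uses just the additive structure of
   Z[i]/(pi), and for k = 0 the ideal is not proper. *)
Definition node (k : nat) := {ideal_quot GRing.ZmodClosed.clone gint (gpi_ideal k) _}.

Definition cls (k : nat) (z : gint) : node k := \pi_(node k) z.

Definition adj (k : nat) : rel (node k) := fun u v =>
  [|| v - u == cls k (GInt 1 0), v - u == cls k (GInt (-1) 0),
      v - u == cls k (GInt 0 1) | v - u == cls k (GInt 0 (-1))].

Definition linked (k : nat) (u v : node k) (n : nat) : bool :=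
  `[< exists p : seq (node k), [/\ path (@adj k) u p, last u p = v & size p = n] >].

(* The default value is never used, G_k being connected. *)
Definition gdist (k : nat) (u v : node k) : nat :=
  if pselect (exists n, linked u v n) is left h then ex_minn h else 0%N.

(* The pairs by which nodes are given, as input and as output. *)
Definition is_rep (k : nat) (z : gint) : bool := `|re z| + `|im z| <= k%:Z.

(* The default value is never used: each class has exactly one such w. *)
Definition reduce (k : nat) (z : gint) : gint :=
  xget 0 [set w : gint | is_rep k w /\ cls k w = cls k z].

(** * Unit-cost programs *)

(* A random access machine on integers with while-programs. Its cells, indexed
   by integers, hold integers; programs do not depend on k, but the distance and
   reduction operations refer to the network G_k on which the program is run. *)

Definition memory := int -> int.

Definition set_cell (m : memory) (a v : int) : memory :=
  fun b => if b == a then v else m b.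

Inductive expr :=
| Const of int
| Cell of expr
| Add of expr & expr
| Sub of expr & expr
| Mul of expr & expr
| Div of expr & expr
| Mod of expr & expr
| Dist of expr & expr & expr & expr. (* distance from (e1, e2) to (e3, e4) *)

Inductive test :=
| Eq of expr & expr
| Le of expr & expr
| Not of test
| And of test & test.

Inductive cmd :=
| Skip
| Store of expr & expr (* address, value *)
| Reduce of expr & expr & expr & expr
  (* Reduce a b x y puts the representative of x + yi in cells a and b *)
| Seq of cmd & cmd
| If of test & cmd & cmd
| While of test & cmd.

Fixpoint eval (k : nat) (m : memory) (e : expr) : int :=
  match e with
  | Const c => c
  | Cell e1 => m (eval k m e1)
  | Add e1 e2 => eval k m e1 + eval k m e2
  | Sub e1 e2 => eval k m e1 - eval k m e2
  | Mul e1 e2 => eval k m e1 * eval k m e2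
  | Div e1 e2 => (eval k m e1 %/ eval k m e2)%Z
  | Mod e1 e2 => (eval k m e1 %% eval k m e2)%Z
  | Dist e1 e2 e3 e4 =>
      (gdist (cls k (GInt (eval k m e1) (eval k m e2)))
             (cls k (GInt (eval k m e3) (eval k m e4))))%:Z
  end.

Fixpoint holds (k : nat) (m : memory) (b : test) : bool :=
  match b with
  | Eq e1 e2 => eval k m e1 == eval k m e2
  | Le e1 e2 => eval k m e1 <= eval k m e2
  | Not b1 => ~~ holds k m b1
  | And b1 b2 => holds k m b1 && holds k m b2
  end.

Fixpoint ecost (e : expr) : nat :=
  match e with
  | Const _ => 1
  | Cell e1 => (ecost e1).+1
  | Add e1 e2 | Sub e1 e2 | Mul e1 e2 | Div e1 e2 | Mod e1 e2 =>
      (ecost e1 + ecost e2).+1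
  | Dist e1 e2 e3 e4 => (ecost e1 + ecost e2 + ecost e3 + ecost e4).+1
  end.

Fixpoint tcost (b : test) : nat :=
  match b with
  | Eq e1 e2 | Le e1 e2 => (ecost e1 + ecost e2).+1
  | Not b1 => (tcost b1).+1
  | And b1 b2 => (tcost b1 + tcost b2).+1
  end.

(* exec k c m m' t : run on G_k from memory m, the program c halts with memory
   m' in time t. This relation is deterministic; a diverging run satisfies it
   for no m' and t. *)
Inductive exec (k : nat) : cmd -> memory -> memory -> nat -> Prop :=
| ExecSkip m : exec k Skip m m 1
| ExecStore a e m :
    exec k (Store a e) m (set_cell m (eval k m a) (eval k m e))
      (ecost a + ecost e).+1
| ExecReduce a b x y m (w := reduce k (GInt (eval k m x) (eval k m y))) :
    exec k (Reduce a b x y) m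
      (set_cell (set_cell m (eval k m a) (re w)) (eval k m b) (im w))
      (ecost a + ecost b + ecost x + ecost y).+1
| ExecSeq c1 c2 m m1 m2 t1 t2 :
    exec k c1 m m1 t1 -> exec k c2 m1 m2 t2 ->
    exec k (Seq c1 c2) m m2 (t1 + t2)
| ExecIf b c1 c2 m m1 t :
    exec k (if holds k m b then c1 else c2) m m1 t ->
    exec k (If b c1 c2) m m1 (tcost b + t).+1
| ExecWhileStop b c m :
    ~~ holds k m b -> exec k (While b c) m m (tcost b).+1
| ExecWhileStep b c m m1 m2 t1 t2 :
    holds k m b -> exec k c m m1 t1 -> exec k (While b c) m1 m2 t2 ->
    exec k (While b c) m m2 (tcost b + t1 + t2).+1.

(* Cell 0 holds k, cell 1 the number of faulty nodes, and the cells from 2 on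
   their successive coordinates; all other cells hold 0. *)
Definition input (k : nat) (F : seq gint) : memory :=
  fun a =>
    if a is Posz n then
      nth 0 (k%:Z :: (size F)%:Z :: flatten [seq [:: re f; im f] | f <- F]) n
    else 0.

Definition output (m : memory) : gint := GInt (m 0) (m 1).

(* Main.v *)
(** Nonzero elements of the ideal (pi) have l1 norm at least 2k+1, so the distance
    between two nodes differing by z is |x| + |y| as soon as this is at most k.
    In the coordinates s = x + y, t = y - x the sphere of radius k is the set of
    the points with s = t mod 2 on the boundary of the square [-k, k]^2. The
    spheres around 0 and d = (s, t) contain a common point of this boundary,
    such as (k, t - k) when s, t >= 0, provided that |s|, |t| <= 2k; its
    parity is right if and only if s and t are even. If they are odd, then subtracting
    or adding pi, which is (2k+1, 1) in these coordinates, makes them even. So a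
    point at distance k from both faults is found without any search. *)

Require Import Defs.
From mathcomp Require Import all_boot all_order all_algebra.
From mathcomp Require Import ring zify.
From mathcomp Require Import boolp classical_sets.

Set Implicit Arguments.
Unset Strict Implicit.
Unset Printing Implicit Defensive.

Import Defs Order.TTheory GRing.Theory Num.Theory.
Local Open Scope ring_scope.
Local Open Scope quotient_scope.

(** * The l1 norm on Gaussian integers *)

Definition l1 (z : gint) : nat := (`|re z| + `|im z|)%N.
Arguments l1 z%_R.

Lemma is_repE k z : is_rep k z = (l1 z <= k)%N.
Proof. by rewrite /is_rep /l1; lia. Qed.

Lemma reD (z w : gint) : re (z + w) = re z + re w. Proof. by []. Qed.
Lemma imD (z w : gint) : im (z + w) = im z + im w. Proof. by []. Qed.
Lemma reN (z : gint) : re (- z) = - re z. Proof. by []. Qed.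
Lemma imN (z : gint) : im (- z) = - im z. Proof. by []. Qed.

Lemma l1_eq0 z : l1 z = 0%N -> z = 0.
Proof. by case: z => x y; rewrite /l1 /= => h; congr GInt; lia. Qed.

Lemma l1_triangle (z w : gint) : (l1 (z + w) <= l1 z + l1 w)%N.
Proof. by rewrite /l1 reD imD; lia. Qed.

Lemma l1N (z : gint) : l1 (- z) = l1 z.
Proof. by rewrite /l1 reN imN; lia. Qed.

(** * Distances and representatives in [G_k] *)

Section Network.
Variable k : nat.

Lemma clsD (z w : gint) : cls k (z + w) = cls k z + cls k w.
Proof. exact: raddfD. Qed.

Lemma clsB (z w : gint) : cls k (z - w) = cls k z - cls k w.
Proof. exact: raddfB. Qed.

Lemma cls_eq (z w : gint) : (cls k z == cls k w) = (z - w \in gpi_ideal k).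
Proof. by rewrite -Quotient.idealrBE. Qed.

Lemma cls_mul (q : gint) : cls k (q * gpi k) = 0.
Proof.
apply/eqP; rewrite -[0](raddf0 (\pi_(node k))) -/(cls k 0) cls_eq subr0.
by apply/asboolP; exists q.
Qed.

(* With [n = 2k+1] and [q = a + bi], the element [q pi] has [x + y = a n - b]
   and [y - x = a + b n], which determine [a (n^2+1)] and [b (n^2+1)]. *)
Lemma ideal_l1_eq0 (z : gint) : z \in gpi_ideal k -> (l1 z <= 2 * k)%N -> z = 0.
Proof.
move=> /asboolP[[a b] ->]; rewrite /l1 /=.
set x := _ - _; set y := _ + _ => h; set n : int := 2 * k%:Z + 1.
have ub (u : int) : `|u| <= 2 * k%:Z -> `|u * n| <= 2 * k%:Z * n.
  by move=> uk; rewrite normrM (_ : `|n| = n) ?ler_wpM2r //; rewrite /n; lia.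
have c0 (c u v : int) : `|u| <= 2 * k%:Z -> `|v| <= 2 * k%:Z ->
    c * (n ^+ 2 + 1) = u * n + v -> c = 0.
  move=> /ub un vk e.
  (* Since [2k = n - 1], the left side is [(n - 1)(n + 1) = n^2 - 1], too small for a nonzero
     multiple of [n^2 + 1]. *)
  have N : 2 * k%:Z * n + 2 * k%:Z < n ^+ 2 + 1 by rewrite /n; lia.
  have [c0|c0|//] := ltgtP c 0.
    have : - c * (n ^+ 2 + 1) >= n ^+ 2 + 1 by rewrite ler_peMl; lia.
    by rewrite mulNr; lia.
  have : c * (n ^+ 2 + 1) >= n ^+ 2 + 1 by rewrite ler_peMl; lia.
  by lia.
have a0 : a = 0.
  by apply: (c0 a (x + y) (y - x)); rewrite /x /y /n; [lia|lia|ring].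
have b0 : b = 0.
  by apply: (c0 b (y - x) (- (x + y))); rewrite /x /y /n; [lia|lia|ring].
by rewrite /x /y a0 b0; congr GInt => /=; ring.
Qed.

Lemma cls_inj_l1 (z w : gint) : (l1 z + l1 w <= 2 * k)%N -> cls k z = cls k w -> z = w.
Proof.
move=> h /eqP; rewrite cls_eq => /ideal_l1_eq0 e.
apply/eqP; rewrite -subr_eq0; apply/eqP/e.
by apply: leq_trans h; rewrite -(l1N w) l1_triangle.
Qed.

(** Each edge lifts to a unit of [Z[i]], and [z] is the sum of these units. *)
Lemma linkedP u v n :
  linked u v n ->
  exists2 z, (l1 z <= n)%N & v = u + cls k z.
Proof.
move=> /asboolP[p [+ <- <-]]; elim: p u => [|x p IHp] u /=.
  by exists 0 => //; rewrite /cls raddf0 addr0.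
move=> /andP[ux /IHp[z zp ->]].
have [e e1 /eqP ex] : exists2 e, l1 e = 1%N & x - u == cls k e.
  by case/or4P: ux; [exists (GInt 1 0)|exists (GInt (-1) 0)
    |exists (GInt 0 1)|exists (GInt 0 (-1))].
exists (e + z); first by have := l1_triangle e z; lia.
by rewrite clsD -ex addrA subrKC.
Qed.

Lemma linked_l1 u z : linked u (u + cls k z) (l1 z).
Proof.
move en : (l1 z) => n; elim: n u z en => [|n IHn] u z zn.
  rewrite (l1_eq0 zn) /cls raddf0 addr0; apply/asboolP.
  by exists [::].
have [e [ue en]] : exists e, adj u (u + cls k e) /\ l1 (z - e) = n.
  case: z zn => x y; rewrite /l1 /= => zn.
  have [x0|x0|x0] := ltgtP x 0.
  - exists (GInt (-1) 0); split; last by rewrite /=; lia.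
    by rewrite /adj addrC addKr eqxx orbT.
  - exists (GInt 1 0); split; last by rewrite /=; lia.
    by rewrite /adj addrC addKr eqxx.
  (* Here [x = 0], and [y] is nonzero because the norm is a successor. *)
  have [y0|y0] := ltP y 0.
  - exists (GInt 0 (-1)); split; last by rewrite /=; lia.
    by rewrite /adj addrC addKr eqxx !orbT.
  - exists (GInt 0 1); split; last by rewrite /=; lia.
    by rewrite /adj addrC addKr eqxx !orbT.
have /asboolP[p [pp pl ps]] := IHn (u + cls k e) (z - e) en.
apply/asboolP; exists (u + cls k e :: p); split; rewrite /= ?ue ?ps //.
by rewrite pl clsB -addrA subrKC.
Qed.

(** A shortest path lifts to some [w] congruent to [z] with [l1 w <= l1 z <= k]; such [w] and [z]
    coincide, so no path beats the norm. *)
Lemma gdist_l1 u z : (l1 z <= k)%N -> gdist u (u + cls k z) = l1 z.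
Proof.
move=> zk; rewrite /gdist; case: pselect => [h|]; last first.
  by case; exists (l1 z); apply: linked_l1.
case: ex_minnP => n /linkedP[w wn /addrI zw] /(_ _ (linked_l1 u z)) nz.
have e : z = w by apply: cls_inj_l1 zw; lia.
by rewrite -e in wn; lia.
Qed.

Lemma exists_rep (z : gint) : exists w, is_rep k w /\ cls k w = cls k z.
Proof.
have [n] := ubnP (l1 z); elim: n z => // n IHn z zn.
have [zk|zk] := leqP (l1 z) k; first by exists z; rewrite is_repE.
have [q qn] : exists q, (l1 (z - q * gpi k) < l1 z)%N.
  case: z zk {zn} => x y; rewrite /l1 /= => zk.
  (* [q] is the unit for which [q * gpi k] lies in the quadrant of [z]. The strict inequality is on
     the coordinate where [q * gpi k] is [k + 1] in absolute value: if that coordinate of [z] were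
     0, the norm could grow. *)
  have [h|[h|[h|h]]] : (0 <= x /\ 0 < y) \/ (x < 0 /\ 0 <= y)
    \/ (x <= 0 /\ y < 0) \/ (0 < x /\ y <= 0) by lia.
  - by exists (GInt 1 0); rewrite /=; lia.
  - by exists (GInt 0 1); rewrite /=; lia.
  - by exists (GInt (-1) 0); rewrite /=; lia.
  - by exists (GInt 0 (-1)); rewrite /=; lia.
have [|w [wk wz]] := IHn (z - q * gpi k); first by lia.
by exists w; rewrite wz clsB cls_mul subr0.
Qed.

(** Existence of a representative rules out the default value of [xget]. *)
Lemma reduceP z : is_rep k (reduce k z) /\ cls k (reduce k z) = cls k z.
Proof. by rewrite /reduce; case: xgetP => [w _ []|/(_ _)] //; have [w hw] := exists_rep z => /(_ w). Qed.

End Network.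

(** * Loop-free programs and their cost *)

Fixpoint loop_free (c : cmd) : bool :=
  match c with
  | Seq c1 c2 | If _ c1 c2 => loop_free c1 && loop_free c2
  | While _ _ => false
  | _ => true
  end.

(* On loops the value is junk. *)
Fixpoint run (k : nat) (c : cmd) (m : memory) : memory :=
  match c with
  | Skip | While _ _ => m
  | Store a e => set_cell m (eval k m a) (eval k m e)
  | Reduce a b x y =>
      let w := reduce k (GInt (eval k m x) (eval k m y)) in
      set_cell (set_cell m (eval k m a) (re w)) (eval k m b) (im w)
  | Seq c1 c2 => run k c2 (run k c1 m)
  | If b c1 c2 => if holds k m b then run k c1 m else run k c2 m
  end.

(** Both branches of a conditional are charged, so the bound depends neither on the memory nor on
    [k]. *)
Fixpoint cost_bound (c : cmd) : nat :=
  match c with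
  | Skip | While _ _ => 1
  | Store a e => (ecost a + ecost e).+1
  | Reduce a b x y => (ecost a + ecost b + ecost x + ecost y).+1
  | Seq c1 c2 => cost_bound c1 + cost_bound c2
  | If b c1 c2 => (tcost b + (cost_bound c1 + cost_bound c2)).+1
  end.

Lemma exec_run k c m : loop_free c ->
  exists2 t, exec k c m (run k c m) t & (t <= cost_bound c)%N.
Proof.
elim: c m => [|a e|a b x y|c1 IH1 c2 IH2|b c1 IH1 c2 IH2|//] m /=.
- by exists 1%N => //; constructor.
- by exists (ecost a + ecost e).+1 => //; constructor.
- by exists (ecost a + ecost b + ecost x + ecost y).+1 => //; constructor.
- move=> /andP[/(IH1 m)[t1 e1 l1] /(IH2 (run k c1 m))[t2 e2 l2]].
  by exists (t1 + t2)%N; [apply: ExecSeq e1 e2|exact: leq_add].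
move=> /andP[/(IH1 m)[t1 e1 l1] /(IH2 m)[t2 e2 l2]].
case hb : (holds k m b).
  exists (tcost b + t1).+1; last by lia.
  by apply: ExecIf; rewrite hb.
exists (tcost b + t2).+1; last by lia.
by apply: ExecIf; rewrite hb.
Qed.

(** * Common points of two spheres *)

(* Coordinates [x + y] and [y - x] turn [l1] into the maximum norm. *)
Lemma common_sphere_point (k : nat) (x y h : int) :
  y - x = 2 * h -> (l1 (GInt x y) <= 2 * k)%N ->
  let z := if 0 <= x + y then if 0 <= h then GInt (k%:Z - h) h
                              else GInt (- h) (k%:Z + h)
           else if 0 <= h then GInt (- h) (h - k%:Z)
                else GInt (- k%:Z - h) h in
  l1 z = k /\ l1 (GInt x y - z) = k.
Proof.
move=> e; rewrite /l1 /= => hk.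
(* With [s = x + y] and [t = y - x = 2h], the point [z] has first coordinate [k] or [-k], by the
   sign of [s], and second coordinate [t - k] or [t + k], by that of [t]. So [z] attains [k] in the
   first coordinate and the difference in the second. *)
by case: ifP => s; case: ifP => t /=; split; lia.
Qed.

(* The translation that makes [x + y] even without leaving the ball of radius [2k]. *)
Definition parity_shift (d : gint) : gint :=
  if (re d + im d) %% 2 == 1 :> int then if 1 <= re d + im d then 1 else -1 else 0.

(** Odd [s] and [t] are at most [2k - 1] in absolute value, which leaves room to move [t] by 1; [s]
    moves by [2k + 1] across 0. *)
Lemma parity_shiftP k d : (l1 d <= 2 * k)%N ->
  let d' := d - parity_shift d * gpi k in
  im d' - re d' = 2 * ((im d' - re d') %/ 2)%Z /\ (l1 d' <= 2 * k)%N.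
Proof.
case: d => x y; rewrite /l1 /parity_shift /= => hd.
by case: ifP => [/eqP p|/eqP p]; [case: ifP => s|]; rewrite /=; split; lia.
Qed.

(** * The program and its correctness *)

Definition cell (n : nat) := Cell (Const n).
Definition store (n : nat) (e : expr) := Store (Const n) e.

(* The difference of the faulty nodes, shifted, goes to cells 4 and 5. When only
   one node is given, the origin plays the role of the second one, since the
   unused cells hold 0. *)
Definition even_difference : cmd :=
  Seq (store 4 (Sub (cell 4) (cell 2)))
 (Seq (store 5 (Sub (cell 5) (cell 3)))
      (If (Eq (Mod (Add (cell 4) (cell 5)) (Const 2)) (Const 1))
          (If (Le (Const 1) (Add (cell 4) (cell 5)))
              (Seq (store 4 (Sub (cell 4) (cell 0)))
                   (store 5 (Sub (cell 5) (Add (cell 0) (Const 1)))))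
              (Seq (store 4 (Add (cell 4) (cell 0)))
                   (store 5 (Add (cell 5) (Add (cell 0) (Const 1))))))
          Skip)).

(* The case distinction of [common_sphere_point], with [x + y] in cell 4 and [h]
   in cell 5. *)
Definition sphere_point : cmd :=
  Seq (store 6 (Div (Sub (cell 5) (cell 4)) (Const 2)))
 (Seq (store 4 (Add (cell 4) (cell 5)))
 (Seq (store 5 (cell 6))
      (let out x y :=
         Reduce (Const 0) (Const 1) (Add (cell 2) x) (Add (cell 3) y) in
       If (Le (Const 0) (cell 4))
          (If (Le (Const 0) (cell 5))
              (out (Sub (cell 0) (cell 5)) (cell 5))
              (out (Sub (Const 0) (cell 5)) (Add (cell 0) (cell 5))))
          (If (Le (Const 0) (cell 5))
              (out (Sub (Const 0) (cell 5)) (Sub (cell 5) (cell 0)))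
              (out (Sub (Sub (Const 0) (cell 0)) (cell 5)) (cell 5)))))).

Lemma run_even_difference (k : nat) (m : memory) (f g : gint) :
  m 0%:Z = k -> GInt (m 2%:Z) (m 3%:Z) = f -> GInt (m 4%:Z) (m 5%:Z) = g ->
  let m' := run k even_difference m in
  [/\ m' 0%:Z = k, GInt (m' 2%:Z) (m' 3%:Z) = f &
       GInt (m' 4%:Z) (m' 5%:Z) = g - f - parity_shift (g - f) * gpi k].
Proof.
move=> m0 <- <- m'; rewrite /m' /parity_shift /= /set_cell /=.
by case: ifP => p; [case: ifP => s|]; rewrite /= ?m0; split => //;
  congr GInt => /=; lia.
Qed.

Lemma run_sphere_point (k : nat) (m : memory) (f d : gint) :
  m 0%:Z = k -> GInt (m 2%:Z) (m 3%:Z) = f -> GInt (m 4%:Z) (m 5%:Z) = d ->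
  im d - re d = 2 * ((im d - re d) %/ 2)%Z -> (l1 d <= 2 * k)%N ->
  exists z, [/\ l1 z = k, l1 (d - z) = k &
                output (run k sphere_point m) = reduce k (f + z)].
Proof.
move=> m0 <- <- dh /(common_sphere_point dh).
set z := (if _ then _ else _) => -[z1 z2]; exists z; split => //.
rewrite /z /output /= /set_cell /= m0.
by case: ifP => p; case: ifP => s; rewrite /= ?sub0r; case: reduce.
Qed.

Definition far_node : cmd := Seq even_difference sphere_point.

Lemma run_far_node (k : nat) (m : memory) (f g : gint) :
  m 0%:Z = k -> GInt (m 2%:Z) (m 3%:Z) = f -> GInt (m 4%:Z) (m 5%:Z) = g ->
  (l1 (g - f) <= 2 * k)%N ->
  exists z, [/\ l1 z = k, l1 (g - f - parity_shift (g - f) * gpi k - z) = k &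
                output (run k far_node m) = reduce k (f + z)].
Proof.
move=> m0 mf mg /parity_shiftP[].
rewrite [run k far_node m]/(run k sphere_point (run k even_difference m)).
by have [] := run_even_difference m0 mf mg; apply: run_sphere_point.
Qed.

Lemma gdist_sphere (k : nat) (w z f : gint) :
  l1 z = k -> cls k w = cls k (f + z) -> gdist (cls k w) (cls k f) = k.
Proof.
(* [gdist_l1] measures from the first argument, so [f] is written as [(f + z) - z]. *)
move=> zk ->; rewrite -[in cls k f](addrK z f) [in cls k (_ - z)]clsD.
by rewrite gdist_l1 l1N zk.
Qed.

Theorem mainTheorem4 :
  exists (P : cmd) (C : nat),
  forall (k : nat) (F : seq gint),
    (1 <= k)%N ->
    size F = 1%N \/ size F = 2%N ->
    (forall f : gint, f \in F -> is_rep k f) ->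
    exists (m : memory) (t : nat),
      [/\ exec k P (input k F) m t,
          (t <= C * k)%N,
          is_rep k (output m) &
          forall f : gint, f \in F ->
            gdist (cls k (output m)) (cls k f) = k].
Proof.
exists far_node, (cost_bound far_node) => k F k1 sF Frep.
have [t et tP] : exists2 t, exec k far_node (input k F) (run k far_node (input k F)) t &
    (t <= cost_bound far_node)%N by apply: exec_run.
have [f [g [fr gr FE [i0 i2 i4]]]] : exists f g,
    [/\ is_rep k f, is_rep k g, {subset F <= [:: f; g]} &
        let i := input k F in
        [/\ i 0%:Z = k, GInt (i 2%:Z) (i 3%:Z) = f &
             GInt (i 4%:Z) (i 5%:Z) = g]].
  case: F sF Frep {et} => [|f [|g [|? ?]]] [] // _ Frep;
    [exists f, 0|exists f, g].
  - split; [by apply: Frep; rewrite inE|by rewrite is_repE| |by case: (f)].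
    by move=> h; rewrite !inE => ->.
  - split; [by apply: Frep; rewrite inE eqxx|
            by apply: Frep; rewrite !inE eqxx orbT|by []|].
    by case: (f) (g) => ? ? [].
have [|z [zk dk zE]] := run_far_node i0 i2 i4.
  apply: leq_trans (l1_triangle _ _) _.
  by rewrite l1N; move: fr gr; rewrite !is_repE; lia.
have [wr wE] := reduceP k (f + z).
exists (run k far_node (input k F)), t; rewrite zE; split => //.
  (* The constant bound is at most [C * k] because [1 <= k]. *)
  by apply: leq_trans tP _; rewrite leq_pmulr.
move=> h /FE; rewrite !inE => /orP[]/eqP-> {h}; first exact: gdist_sphere zk wE.
(* With [d'] the shifted difference, [f + z] is [g - (d' - z)] up to a multiple of [gpi k]. *)
apply: (@gdist_sphere _ _ (- (g - f - parity_shift (g - f) * gpi k - z))).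
  by rewrite l1N.
rewrite wE (_ : g + _ = f + z + parity_shift (g - f) * gpi k).
  by rewrite [RHS]clsD cls_mul addr0.
by ring.
Qed.
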